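(* Let $\mathcal{C}$ be a class of graphs with bounded expansion and let $h \geq 1$ be an integer. Then there exists an integer $d$ (depending only on $\mathcal{C}$ and $h$) such that every finite poset $P$ of height $h$ whose cover graph belongs to $\mathcal{C}$ satisfies $\dim(P) \leq d$.
   Context: All posets are finite; all graphs are finite, simple and undirected. The height of a poset is the maximum size of a chain. The cover graph of a poset $P$ is the undirected graph on the points of $P$ whose edges are the pairs $\{x,y\}$ with $x<y$ in $P$ and no $z\in P$ with $x<z<y$ in $P$. The dimension $\dim(P)$ is the least $d$ such that there are $d$ linear extensions of $P$ whose intersection is $P$. For a partition $\mathcal{X}$ of $V(G)$ into non-empty parts inducing connected subgraphs, $G/\mathcal{X}$ is the graph with vertex set $\mathcal{X}$ in which two distinct parts $X,Y$ are adjacent if and only if $xy\in E(G)$ for some $x\in X$, $y\in Y$. The radius of a connected graph $G$ is the least $r\ge 0$ such that some vertex of $G$ is at distance at most $r$ from all vertices of $G$. A graph $H$ is a depth-$r$ minor of $G$ if $H$ is isomorphic to a subgraph of $G/\mathcal{X}$ for some partition $\mathcal{X}$ of $V(G)$ into non-empty parts inducing (connected) subgraphs of radius at most $r$. Put $\nabla_r(G)=\max\{|E(H)|/|V(H)| : H \text{ is a depth-}r\text{ minor of } G\}$. A class of graphs $\mathcal{C}$ has bounded expansion if there is a function $f:\mathbb{R}\to\mathbb{R}$ such that $\nabla_r(G)\leq f(r)$ for every integer $r\geq 0$ and every $G\in\mathcal{C}$. *)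

(* Defs.v *)
From HB Require Import structures.
From mathcomp Require Import boolp classical_sets reals.
From mathcomp Require Import all_boot all_order all_algebra.

Set Implicit Arguments.
Unset Strict Implicit.
Unset Printing Implicit Defensive.

Import Order.TTheory GRing.Theory Num.Theory.

Record sgraph := SGraph {
  vertex :> finType;
  adj : rel vertex;
  adj_sym : symmetric adj;
  adj_irr : irreflexive adj }.

Arguments adj {s} _ _ : rename.

Definition edges (G : sgraph) : {set {set G}} :=
  [set [set p.1; p.2] | p in [pred p : G * G | adj p.1 p.2]].

Definition connected (G : sgraph) : bool :=
  [forall x : G, forall y : G, connect adj x y].

Section Distance.
Variable G : sgraph.

Definition walk (n : nat) (x y : G) : bool :=
  [exists p : n.-tuple G, path adj x p && (last x p == y)].

(* On a finite range, [find] returns the least witness, or the range bound if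
   there is none: [dist x y = #|G|] (larger than any finite distance) when [x]
   and [y] are in different components. *)
Definition dist (x y : G) : nat :=
  find (fun n => walk n x y) (iota 0 #|G|).

(* Meaningful when [G] is connected and nonempty. *)
Definition radius : nat :=
  find (fun r => [exists c : G, [forall x : G, dist c x <= r]]) (iota 0 #|G|).

Lemma dist_leP (x y : G) (n : nat) : connect adj x y ->
  reflect (exists p : seq G, [/\ path adj x p, last x p = y & size p <= n])
          (dist x y <= n).
Proof.
move=> cxy.
have hw : has (fun n => walk n x y) (iota 0 #|G|).
  have [p ep ->] := connectP cxy.
  have [p' ep' up' _] := shortenP ep.
  apply/hasP; exists (size p').
    by rewrite mem_iota add0n -[(size p').+1]/(size (x :: p')) -(card_uniqP up') max_card.
  by apply/existsP; exists (in_tuple p'); rewrite ep' eqxx.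
have dG : dist x y < #|G| by rewrite /dist -[X in _ < X](size_iota 0) -has_find.
apply: (iffP idP) => [le_n|[p [ep lp sp]]].
  have := nth_find 0 hw; rewrite -/(dist x y) nth_iota // add0n.
  case/existsP=> p /andP[ep /eqP lp].
  by exists p; rewrite size_tuple.
rewrite leqNgt; apply/negP => lt_n.
have := before_find 0 (leq_ltn_trans sp lt_n : size p < find _ (iota 0 #|G|)).
rewrite nth_iota ?add0n; last exact: leq_ltn_trans sp (ltn_trans lt_n dG).
by move/negbT/negP; apply; apply/existsP; exists (in_tuple p); rewrite ep lp eqxx.
Qed.

Lemma radius_leP (r : nat) : connected G -> 0 < #|G| ->
  reflect (exists c : G, forall x : G, exists p : seq G,
             [/\ path adj c p, last c p = x & size p <= r])
          (radius <= r).
Proof.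
move=> cG G0.
have cc (x y : G) : connect adj x y by move/forallP: cG => /(_ x)/forallP/(_ y).
set Q := fun r => [exists c : G, [forall x : G, dist c x <= r]].
have hQ : has Q (iota 0 #|G|).
  apply/hasP; exists #|G|.-1; first by rewrite mem_iota add0n ltn_predL.
  have [c _] := card_gt0P G0.
  apply/existsP; exists c; apply/forallP => x.
  have [p ep px] := connectP (cc c x).
  move: px; have [p' ep' up' _ px'] := shortenP ep.
  apply/(dist_leP _ (cc c x)); exists p'; split => //.
  by rewrite -ltnS prednK // -[(size p').+1]/(size (c :: p')) -(card_uniqP up') max_card.
have rG : radius < #|G| by rewrite /radius -[X in _ < X](size_iota 0) -has_find.
apply: (iffP idP) => [le_r|[c hc]].
  have := nth_find 0 hQ; rewrite -/radius nth_iota // add0n.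
  case/existsP=> c /forallP hc; exists c => x.
  exact/(dist_leP _ (cc c x))/(leq_trans (hc x)).
rewrite leqNgt; apply/negP => lt_r.
have := before_find 0 (lt_r : r < find Q (iota 0 #|G|)).
rewrite nth_iota ?add0n; last exact: ltn_trans rG.
move/negbT/negP; apply; apply/existsP; exists c; apply/forallP => x.
exact/(dist_leP _ (cc c x)).
Qed.

End Distance.

Section Minors.
Variable G : sgraph.

Section Induced.
Variable X : {set G}.

Definition induced_adj : rel {x : G | x \in X} :=
  fun u v => adj (val u) (val v).

Fact induced_sym : symmetric induced_adj.
Proof. by move=> u v; apply: adj_sym. Qed.

Fact induced_irr : irreflexive induced_adj.
Proof. by move=> u; apply: adj_irr. Qed.

Definition induced : sgraph := SGraph induced_sym induced_irr.
End Induced.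

Section Quotient.
Variable XX : {set {set G}}.

Definition quotient_adj : rel {X : {set G} | X \in XX} := fun X Y =>
  (X != Y) && [exists x in val X, exists y in val Y, adj x y].

Fact quotient_sym : symmetric quotient_adj.
Proof.
move=> X Y; rewrite /quotient_adj eq_sym; congr (_ && _).
by apply/exists_inP/exists_inP => -[x xX /exists_inP[y yY xy]];
  exists y => //; apply/exists_inP; exists x; rewrite // adj_sym.
Qed.

Fact quotient_irr : irreflexive quotient_adj.
Proof. by move=> X; rewrite /quotient_adj eqxx. Qed.

Definition quotient : sgraph := SGraph quotient_sym quotient_irr.
End Quotient.

End Minors.

Definition iso_to_subgraph (H K : sgraph) : Prop :=
  exists2 f : H -> K, injective f & forall x y, adj x y -> adj (f x) (f y).

Definition depth_minor (r : nat) (H G : sgraph) : Prop :=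
  exists XX : {set {set G}},
    [/\ partition XX [set: G],
        forall X, X \in XX -> connected (induced X) && (radius (induced X) <= r)
      & iso_to_subgraph H (quotient XX)].

Section Expansion.
Variable R : realType.
Local Open Scope ring_scope.

(* The graph with no vertices gets density [0 / 0 = 0]. *)
Definition density (H : sgraph) : R := #|edges H|%:R / #|H|%:R.

(* This supremum is a maximum, see [nabla_max] below. *)
Definition nabla (r : nat) (G : sgraph) : R :=
  sup [set x | exists2 H : sgraph, depth_minor r H G & x = density H]%classic.

Definition bounded_expansion (C : sgraph -> Prop) : Prop :=
  exists f : R -> R, forall (r : nat) (G : sgraph), C G -> nabla r G <= f r%:R.

Lemma depth_minor_card r H G : depth_minor r H G -> (#|H| <= #|G|)%N.
Proof.
case=> XX [pX _ [f finj _]].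
rewrite (leq_trans (leq_card f finj)) //= card_sig.
case/and3P: pX => /eqP cX tX nX.
rewrite -cardsT -cX; move/eqP: tX => <-.
rewrite -sum1_card big_mkcond [leqRHS]big_mkcond; apply: leq_sum => X _.
rewrite !inE; case: ifP => // XXX; rewrite card_gt0.
by apply: contraNneq nX => <-.
Qed.

Lemma card_edges_le H : (#|edges H| <= #|H| * #|H|)%N.
Proof. by rewrite -card_prod (leq_trans (leq_imset_card _ _)) ?max_card. Qed.

Lemma depth_minor_refl r G : depth_minor r G G.
Proof.
exists [set [set x] | x in [set: G]]; split.
- apply/and3P; split; last first.
  + by apply/imsetP => -[x _] /setP/(_ x); rewrite !inE eqxx.
  + apply/trivIsetP => _ _ /imsetP[x _ ->] /imsetP[y _ ->] xy.
    by rewrite disjoints1 inE; apply: contraNneq xy => ->.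
  + rewrite cover_imset; apply/eqP/setP => x; rewrite inE.
    by apply/bigcupP; exists x; rewrite !inE.
- move=> _ /imsetP[x _ ->].
  have eqv (u v : induced [set x]) : u = v.
    apply: val_inj; have := valP u; have := valP v; rewrite !inE.
    by move=> /eqP -> /eqP ->.
  have cn : connected (induced [set x]).
    by apply/forallP => u; apply/forallP => v; rewrite (eqv u v) connect0.
  rewrite cn /=; apply/radius_leP => //.
    by rewrite /= card_sig; apply/card_gt0P; exists x; rewrite !inE.
  exists (Sub x (set11 x)) => y; exists [::]; split => //=; exact: eqv.
- exists (fun x => Sub [set x] (imset_f _ (in_setT x))) => [x y|x y xy].
    by case=> /setP/(_ x); rewrite !inE eqxx => /esym/eqP.
  apply/andP; split; last first.
    apply/exists_inP; exists x; first by rewrite SubK inE.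
    by apply/exists_inP; exists y; rewrite // SubK inE.
  rewrite -val_eqE /=; apply: contraTneq xy => /setP/(_ x).
  by rewrite !inE eqxx => /esym/eqP ->; rewrite adj_irr.
Qed.

Lemma nabla_max r G :
  (exists2 H, depth_minor r H G & nabla r G = density H) /\
  (forall H, depth_minor r H G -> density H <= nabla r G).
Proof.
set n := #|G|.
set D := [set x | exists2 H : sgraph, depth_minor r H G & x = density H]%classic.
pose I := ('I_(n * n).+1 * 'I_n.+1)%type.
pose v (i : I) : R := i.1%:R / i.2%:R.
pose P := [pred i : I | `[< D (v i) >]].
have DP H : depth_minor r H G -> exists2 i, P i & density H = v i.
  move=> mH; have hn := depth_minor_card mH.
  have he : (#|edges H| < (n * n).+1)%N.
    by rewrite ltnS (leq_trans (card_edges_le H)) ?leq_mul.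
  exists (Ordinal he, Ordinal (hn : (#|H| < n.+1)%N)) => //.
  by apply/asboolP; exists H.
have [i0 Pi0 _] := DP _ (depth_minor_refl r G).
have [i Pi imax] := @Order.TotalTheory.arg_maxP _ _ _ i0 P v Pi0.
have [H mH dH] : D (v i) by move/asboolP: Pi.
have ubD : ubound D (v i).
  by move=> _ [K mK ->]; have [j Pj ->] := DP _ mK; apply: imax.
have supE : nabla r G = v i.
  apply/eqP; rewrite eq_le; apply/andP; split.
    by apply: ge_sup => //; exists (v i); exists H.
  by apply: ub_le_sup; [exists (v i)|exists H].
split; first by exists H; rewrite // supE dH.
by move=> K mK; rewrite supE; apply: ubD; exists K.
Qed.

End Expansion.

Section Posets.
Variables (disp : Order.disp_t) (P : finPOrderType disp).
Local Open Scope order_scope.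

Definition chain (A : {set P}) : bool :=
  [forall x in A, forall y in A, x >=< y].

Definition poset_height : nat := \max_(A : {set P} | chain A) #|A|.

Definition covered_by (x y : P) : bool :=
  (x < y) && ~~ [exists z : P, (x < z) && (z < y)].

Definition cover_adj : rel P := fun x y => covered_by x y || covered_by y x.

Fact cover_sym : symmetric cover_adj.
Proof. by move=> x y; rewrite /cover_adj orbC. Qed.

Fact cover_irr : irreflexive cover_adj.
Proof. by move=> x; rewrite /cover_adj /covered_by ltxx. Qed.

Definition cover_graph : sgraph := SGraph cover_sym cover_irr.

Definition linear_extension (L : rel P) : Prop :=
  [/\ antisymmetric L, transitive L, total L & subrel <=%O L].

(* For [d = 0] the intersection is the full relation on [P]. *)
Definition realizer (d : nat) (L : 'I_d -> rel P) : Prop :=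
  (forall i, linear_extension (L i)) /\
  (forall x y, (x <= y) = [forall i, L i x y]).

Lemma linear_extension_sep (x y : P) :
  exists2 L : rel P, linear_extension L & ~~ (x <= y) -> ~~ L x y.
Proof.
pose c (z : P) : nat := #|[set w : P | w <= z]|.
pose key (z : P) : (nat *l (nat *l nat))%type :=
  (nat_of_bool (x <= z), (c z, nat_of_ord (enum_rank z))).
exists (fun u v => key u <= key v).
  split.
  - move=> u v /le_anti[_ _ e]; exact/enum_rank_inj/ord_inj.
  - by move=> v u w; apply: le_trans.
  - by move=> u v; apply: le_total.
  - move=> u v; rewrite le_eqVlt => /predU1P[->//|uv].
    have cuv : (c u < c v)%N.
      apply: proper_card; apply/properP; split.
        by apply/subsetP => w; rewrite !inE => /le_trans; apply; apply: ltW.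
          by exists v; rewrite !inE ?(lt_geF uv).
    have buv : ((x <= u)%O <= (x <= v)%O)%N.
      by case xu: (x <= u); rewrite // (le_trans xu (ltW uv)).
    rewrite lexi_pair; apply/andP; split=> //; apply/implyP => _.
    by rewrite lexi_pair; apply/andP; split; rewrite leEnat ?(ltnW cuv) // leqNgt cuv.
move=> /negbTE nxy; apply/negP; rewrite lexi_pair => /andP[].
by rewrite lexx nxy leEnat.
Qed.

Lemma realizer_ex : exists d, `[< exists L : 'I_d -> rel P, realizer L >].
Proof.
have /choice[L hL] : forall p : P * P, exists L : rel P,
    linear_extension L /\ (~~ (p.1 <= p.2) -> ~~ L p.1 p.2).
  by move=> [x y]; have [L ? ?] := linear_extension_sep x y; exists L.
exists #|{: P * P}|; apply/asboolP; exists (fun i => L (enum_val i)); split.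
  by move=> i; have [] := hL (enum_val i).
move=> x y; apply/idP/forallP => [xy i|h].
  by have [[_ _ _ s] _] := hL (enum_val i); apply: s.
apply: contraT => nxy; have [_ /(_ nxy)] := hL (x, y).
by have := h (enum_rank (x, y)); rewrite enum_rankK => ->.
Qed.

Definition poset_dim : nat := ex_minn realizer_ex.

End Posets.

Arguments poset_height {disp} P.
Arguments cover_graph {disp} P.
Arguments poset_dim {disp} P.

(* Main.v *)
(* The proof goes through weak colouring numbers.

   Let [T] be a set of vertices of a graph whose shallow minors are sparse, and
   grow disjoint small balls around the points of [T] so as to maximise the
   number of adjacent pairs of balls. There are O(|T|) such pairs, hence the
   balls have O(|T|) points in all, and a short path between points of [T] whose
   balls are not adjacent meets some ball in its interior. Iterating with the
   union of the balls in the role of [T] gives O(|T|) pairs [(v, w)] such that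
   every short walk from [v \in T] to another point of [T] meets a partner [w] of
   [v]. Some [v] in [T] has boundedly many partners; removing such vertices one
   by one orders the graph so that all weakly reachable sets are bounded, and a
   greedy colouring makes a vertex differ from those weakly reachable from it.

   In a poset of height [h + 1] with cover graph so ordered and coloured, give a
   pair [x, y] with [~~ (x <= y)] a signature: the colours of the points [z]
   above [x] that are minimal on a short walk from [x] to [z], those of the
   similar points below [y], and how the points of equal colour above [x] and
   below [y] are ordered. An alternating cycle of pairs with equal signatures,
   followed from its least point [z] in a direction chosen by the signature,
   would give an infinite descent among the points coloured like [z]. So the
   pairs with a given signature are reversed by one linear extension, and the
   dimension is at most the number of signatures. *)

Require Import Defs.
From mathcomp Require Import all_boot all_order all_algebra.
From mathcomp Require Import reals boolp.

Set Implicit Arguments.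
Unset Strict Implicit.
Unset Printing Implicit Defensive.

Import Order.TTheory GRing.Theory Num.Theory.

(** * Sparsity of shallow minors *)

Definition sparse (D r : nat) (G : sgraph) : Prop :=
  forall H : sgraph, depth_minor r H G -> #|edges H| <= D * #|H|.

Lemma bounded_expansion_sparse (R : realType) (C : sgraph -> Prop) (r : nat) :
  bounded_expansion R C -> exists D, forall G, C G -> sparse D r G.
Proof.
case=> f hf; exists (Num.bound `|f r%:R|%R) => G CG H mH.
(* Without vertices the density is [0 / 0 = 0] and says nothing about edges, but then there are
   none. *)
have [H0|H0] := posnP #|H|.
  by have := card_edges_le H; rewrite H0 !muln0.
have := le_trans ((nabla_max R r G).2 H mH) (hf r G CG).
rewrite /density ler_pdivrMr ?ltr0n // => le.
rewrite -(ler_nat R) natrM; apply: le_trans le _.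
by rewrite ler_wpM2r // (le_trans (ler_norm _)) // ltW // archi_boundP.
Qed.

(** The factor 2 is the choice of orientation: an ordered pair is recovered from its edge and from
    which end is enumerated first. *)
Lemma card_adj_pairs (H : sgraph) :
  #|[set p : H * H | adj p.1 p.2]| <= 2 * #|edges H|.
Proof.
pose f (p : H * H) := ([set p.1; p.2], enum_rank p.1 < enum_rank p.2).
have finj : {in [set p : H * H | adj p.1 p.2] &, injective f}.
  move=> [a b] [a' b'] _ _ [/= e lt].
  have ha : a \in [set a'; b'] by rewrite -e !inE eqxx.
  have hb : b \in [set a'; b'] by rewrite -e !inE eqxx orbT.
  have ha' : a' \in [set a; b] by rewrite e !inE eqxx.
  have hb' : b' \in [set a; b] by rewrite e !inE eqxx orbT.
  move: ha hb ha' hb'; rewrite !inE.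
  have [<-|na] := eqVneq a a' => /=.
    by move=> _ /orP[/eqP->|/eqP-> //] _ /orP[] /eqP->.
  move=> /eqP aE _ /eqP bE _; move: lt.
  by rewrite aE bE; case: ltngtP => // /ord_inj/enum_rank_inj->.
rewrite mulnC -(card_in_imset finj) -card_bool -(cardsT bool) -cardsX.
apply/subset_leq_card/subsetP => _ /imsetP[p pH ->].
by rewrite !inE /= andbT; apply/imsetP; exists p => //; rewrite inE in pH.
Qed.

(** * Disjoint balls around the points of a set *)

Definition hits (G : sgraph) (N : nat) (T : {set G}) (v : G) (W : {set G}) : Prop :=
  forall p, path adj v p -> size p <= N -> last v p \in T -> last v p != v ->
    exists2 w, w \in p & w \in W.

Section Balls.
Variable G : sgraph.
Implicit Types (n : nat) (T : {set G}) (b : {ffun G -> G}).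

(* [b] sends a vertex to the centre of its ball; the centres are the points of
   [T], and the vertices outside the balls are sent to themselves. *)
Definition ball_map n T b : Prop :=
  [/\ forall t, t \in T -> b t = t,
      forall x, b x \notin T -> b x = x
    & forall x, exists p, [/\ path adj (b x) p, last (b x) p = x, size p <= n
                            & all (fun y => b y == b x) p]].

Definition ball_adj T b : {set G * G} :=
  [set e : G * G | [&& e.1 \in T, e.2 \in T, e.1 != e.2
    & [exists x, exists y, [&& b x == e.1, b y == e.2 & adj x y]]]].

Lemma ball_adjP T b s t :
  reflect [/\ s \in T, t \in T, s != t
            & exists x y, [/\ b x = s, b y = t & adj x y]]
          ((s, t) \in ball_adj T b).
Proof.
rewrite inE /=; apply: (iffP and4P) => -[sT tT st].
  move=> /existsP[x /existsP[y /and3P[/eqP ? /eqP ? ?]]].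
  by split=> //; exists x, y.
move=> [x [y [bx by_ xy]]]; split=> //; apply/existsP; exists x.
by apply/existsP; exists y; rewrite bx by_ !eqxx.
Qed.

Lemma ball_adj_sym T b s t :
  ((s, t) \in ball_adj T b) = ((t, s) \in ball_adj T b).
Proof.
by apply/ball_adjP/ball_adjP => -[sT tT st [x [y [? ? ?]]]]; split=> //;
  rewrite 1?eq_sym //; exists y, x; rewrite adj_sym.
Qed.

Lemma path_induced (X : {set G}) (u : induced X) (p : seq G) :
  path adj (val u) p -> all (fun x => x \in X) p ->
  exists2 q : seq (induced X), path adj u q & map val q = p.
Proof.
elim: p u => [|y p IHp] u /=; first by exists [::].
case/andP=> uy yp /andP[yX pX].
have [q uq qp] := IHp (Sub y yX) yp pX.
by exists (Sub y yX :: q); rewrite /= ?qp // uq andbT.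
Qed.

(** The fibres of [b] are connected of radius at most [n]; contracting them turns adjacent balls
    into adjacent vertices. Fibres outside the balls are singletons, and passing to a subgraph drops
    them. *)
Lemma ball_adj_minor n T b : ball_map n T b ->
  exists H : sgraph, [/\ depth_minor n H G, #|H| = #|T|
    & #|ball_adj T b| = #|[set p : H * H | adj p.1 p.2]|].
Proof.
case=> bT bNT bP.
have bK x : b (b x) = b x.
  by have [/bT|/bNT e] := boolP (b x \in T); rewrite // e.
pose a (u v : {x : G | x \in T}) := (val u, val v) \in ball_adj T b.
have a_sym : symmetric a by move=> u v; apply: ball_adj_sym.
have a_irr : irreflexive a.
  by move=> u; apply/ball_adjP => -[_ _]; rewrite eqxx.
exists (SGraph a_sym a_irr); split.
- pose fib y := [set x | b x == y].
  have fibP y : fib (b y) \in [set fib (b y) | y in G] by apply/imsetP; exists y.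
  exists [set fib (b y) | y in G]; split.
  + apply/and3P; split.
    * apply/eqP/setP => x; rewrite inE; apply/bigcupP.
      by exists (fib (b x)); rewrite ?inE.
    * apply/trivIsetP => _ _ /imsetP[x _ ->] /imsetP[y _ ->] nxy.
      rewrite -setI_eq0; apply/eqP/setP => z; rewrite !inE.
      by apply: contraNF nxy => /andP[/eqP-> /eqP->].
    * by apply/imsetP => -[x _ /setP/(_ x)]; rewrite !inE eqxx.
  + move=> _ /imsetP[y _ ->].
    have byX : b y \in fib (b y) by rewrite inE bK.
    pose c : induced (fib (b y)) := Sub (b y) byX.
    have cP (x : induced (fib (b y))) :
        exists p, [/\ path adj c p, last c p = x & size p <= n].
      have /[!inE] /eqP bx := valP x.
      have [p [cp lp sp ap]] := bP (val x); rewrite bx in cp lp ap.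
      have [|q cq qp] := @path_induced (fib (b y)) c p cp.
        by apply: sub_all ap => z; rewrite inE.
      exists q; split=> //; last by rewrite -(size_map val) qp.
      by apply: val_inj; rewrite -last_map qp.
    have cn : connected (induced (fib (b y))).
      have cx x : connect adj c x.
        by have [p [? ? _]] := cP x; apply/connectP; exists p.
      apply/forallP => u; apply/forallP => v.
      apply: connect_trans (cx v).
      rewrite sym_connect_sym //.
      exact: (@adj_sym (induced _)).
    rewrite cn; apply/radius_leP => //; last by exists c.
    by apply/card_gt0P; exists c.
  + pose f (t : {x : G | x \in T}) : quotient [set fib (b y) | y in G] :=
      Sub (fib (b (val t))) (fibP (val t)).
    exists f => [u v [] /setP/(_ (val u))|u v].
      rewrite !inE eqxx => /esym/eqP.
      by rewrite (bT _ (valP u)) (bT _ (valP v)) => /val_inj.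
    move=> /ball_adjP[uT vT uv [x [y [bx by_ xy]]]].
    apply/andP; split; last first.
      apply/exists_inP; exists x; first by rewrite SubK inE (bT _ uT) bx.
      by apply/exists_inP; exists y; rewrite // SubK inE (bT _ vT) by_.
    rewrite -val_eqE /=; apply: contraNneq uv => /setP/(_ (val u)).
    by rewrite !inE eqxx (bT _ uT) (bT _ vT) => /esym/eqP->.
- by rewrite card_sig; apply: eq_card => x.
- pose g (p : {x : G | x \in T} * {x : G | x \in T}) := (val p.1, val p.2).
  have ginj : injective g by move=> [? ?] [? ?] [/val_inj -> /val_inj ->].
  rewrite -(card_imset _ ginj); apply: eq_card => -[s t].
  apply/idP/imsetP => [st|[[u v] uv [-> ->]]]; last by rewrite inE in uv.
  have /ball_adjP[sT tT _ _] := st.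
  by exists (Sub s sT, Sub t tT) => //; rewrite inE.
Qed.

Lemma card_ball_adj D n T b : sparse D n G -> ball_map n T b ->
  #|ball_adj T b| <= 2 * D * #|T|.
Proof.
move=> GD /ball_adj_minor[H [mH <- ->]].
by rewrite (leq_trans (card_adj_pairs H)) // -mulnA leq_pmul2l // GD.
Qed.

(** The points of [q] outside all balls join the ball of [s]; prefixes of [q] keep its radius at
    most [n], and no other ball changes. The alternative [x == s] admits walks that return to
    [s]. *)
Lemma ball_map_extend n T b s t (q : seq G) : ball_map n T b ->
  s \in T -> t \in T -> s != t -> path adj s (rcons q t) -> size q <= n ->
  all (fun x => (x == s) || (b x \notin T)) q ->
  exists b', [/\ ball_map n T b', (s, t) \in ball_adj T b',
    ball_adj T b \subset ball_adj T b'
    & #|[set x | b' x \in T]| <= #|[set x | b x \in T]| + n].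
Proof.
move=> [bT bNT bP] sT tT st; rewrite rcons_path => /andP[sq qt] sz qP.
pose b' : {ffun G -> G} :=
  [ffun x => if (x \in q) && (b x \notin T) then s else b x].
have b'q x : x \in q -> b' x = s.
  move=> xq; rewrite ffunE xq /=; case: ifP => // /negbFE bx.
  by have /orP[/eqP->|/negP/(_ bx)] := allP qP _ xq; first exact: bT.
have b'T x : b x \in T -> b' x = b x by move=> bx; rewrite ffunE bx andbF.
have b'TT x : x \in T -> b' x = x by move=> xT; rewrite b'T bT.
exists b'; split.
- split=> [//|x|x].
    by rewrite ffunE; case: ifP => [_|_ /bNT//]; rewrite sT.
  have [xq|xq] := boolP (x \in q).
    rewrite (b'q _ xq); have qE := b'q; case/splitPr: xq sq sz qE => q1 q2.
    rewrite -cat_rcons cat_path size_cat => /andP[sx _] sz qE.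
    exists (rcons q1 x); rewrite sx last_rcons (leq_trans (leq_addr _ _) sz).
    split=> //; apply/allP => y yq; apply/eqP/qE.
    by rewrite mem_cat yq.
  have -> : b' x = b x by rewrite ffunE (negbTE xq).
  have [p [xp lp sp ap]] := bP x; have [bx|bx] := boolP (b x \in T).
    exists p; split=> //; apply/allP => y /(allP ap)/eqP yx.
    by rewrite b'T yx.
  by exists [::]; split=> //=; rewrite bNT.
- apply/ball_adjP; split=> //; exists (last s q), t; split=> //; last exact: b'TT.
  case: (lastP q) b'q => [_ /=|q' x b'q]; first exact: b'TT.
  by rewrite last_rcons b'q // mem_rcons mem_head.
- apply/subsetP => -[u v] /ball_adjP[uT vT uv [x [y [bx by_ xy]]]].
  by apply/ball_adjP; split=> //; exists x, y; rewrite !b'T ?bx ?by_.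
- have sub : [set x | b' x \in T] \subset [set x | b x \in T] :|: [set x in q].
    apply/subsetP => x; rewrite !inE orbC; case: (boolP (x \in q)) => //= xq.
    by rewrite ffunE (negbTE xq).
  rewrite (leq_trans (subset_leq_card sub)) //.
  rewrite (leq_trans (leq_card_setU _ _)) // leq_add2l.
  by rewrite cardsE (leq_trans (card_size _)).
Qed.

(* The balls are grown so as to maximise the number of adjacent pairs; a short
   path between two non-adjacent balls could be added to one of them. *)
Lemma maximal_ball_map D n T : sparse D n G ->
  exists b, [/\ ball_map n T b,
    #|[set x | b x \in T]| <= (2 * n * D).+1 * #|T|
    & forall s t q, s \in T -> t \in T -> s != t -> path adj s (rcons q t) ->
        size q <= n -> all (fun x => (x == s) || (b x \notin T)) q ->
        (s, t) \in ball_adj T b].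
Proof.
move=> GD.
(* Each adjacent pair pays for at most [n] ball points, so this bound survives an extension and the
   pairs can be maximised under it. *)
pose good b := ball_map n T b /\
  #|[set x | b x \in T]| <= #|T| + n * #|ball_adj T b|.
pose b0 : {ffun G -> G} := [ffun x => x].
have b0P : `[< good b0 >].
  apply/asboolP; split.
    split=> [t _|x _|x]; rewrite ?ffunE //.
    by exists [::].
  rewrite (leq_trans _ (leq_addr _ _)) // subset_leq_card //.
  by apply/subsetP => x; rewrite inE ffunE.
case: (@arg_maxnP _ b0 (fun b => `[< good b >]) (fun b => #|ball_adj T b|) b0P).
move=> b /asboolP[bP bc] bmax; exists b; split=> //.
  apply: leq_trans bc _; rewrite mulSn leq_add2l (mulnC 2) -!mulnA leq_mul //.
  by rewrite mulnA (card_ball_adj GD).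
move=> s t q sT tT st sq sz qP; apply: contraT => nst.
have [b' [b'P st' sub b'c]] := ball_map_extend bP sT tT st sq sz qP.
have lt : #|ball_adj T b| < #|ball_adj T b'|.
  by apply: proper_card; apply/properP; split=> //; exists (s, t).
have : good b'.
  split=> //; rewrite (leq_trans b'c) // (@leq_trans (#|T| + n * #|ball_adj T b| + n)) //.
    by rewrite leq_add2r.
  by rewrite -addnA -mulnSr leq_add2l leq_mul2l lt orbT.
by move/asboolP/bmax => /=; rewrite leqNgt lt.
Qed.

(** * Hitting sets of bounded size *)

Fixpoint hitting_bound D N n : nat :=
  if n is n'.+1 then 2 * D + hitting_bound D N n' * (2 * N * D).+1 else 0.

(** Induction on [n], with the union of the balls in place of [T]. If the interior of a walk from
    [v] meets no ball except at [v] itself, the balls of its ends are adjacent and its end is the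
    partner. Otherwise it is cut at a ball point other than [v], which leaves a shorter walk within
    the union. The balls have radius [N] at every level, so that one [D] serves throughout. *)
Lemma hitting_relation D N n T : sparse D N G -> n <= N ->
  exists E : {set G * G}, #|E| <= hitting_bound D N n * #|T| /\
    forall v p, v \in T -> path adj v p -> size p <= n -> last v p \in T ->
      last v p != v -> exists2 w, w \in p & (v, w) \in E.
Proof.
move=> GD; elim: n T => [|n IHn] T nN.
  by exists set0; rewrite cards0; split=> // v [|w p] _ _ //= _ _; rewrite eqxx.
have [b [bP bc bmax]] := maximal_ball_map T GD; have [bT _ _] := bP.
have [E [Ec EP]] := IHn [set x | b x \in T] (ltnW nN).
exists (ball_adj T b :|: E); split.
  rewrite (leq_trans (leq_card_setU _ _)) //= mulnDl leq_add //.
    exact: card_ball_adj GD bP.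
  by rewrite (leq_trans Ec) // -mulnA leq_mul2l bc orbT.
move=> v p vT; case: (lastP p) => [|q t]; first by rewrite /= eqxx.
rewrite size_rcons last_rcons => vq sz tT tv.
have [qP|] := boolP (all (fun x => (x == v) || (b x \notin T)) q).
  exists t; first by rewrite mem_rcons mem_head.
  by rewrite inE (bmax v t q) // 1?eq_sym // (ltnW (leq_trans sz nN)).
case/allPn => x xq; rewrite negb_or negbK => /andP[xv bx].
case/splitPr: xq vq sz => q1 q2; rewrite -cat_rcons rcons_cat cat_path.
case/andP=> vq _ sz.
have [|||||w wq vw] := EP v (rcons q1 x); rewrite ?last_rcons ?inE ?(bT _ vT) //.
  by rewrite -ltnS (leq_ltn_trans _ sz) // size_cat leq_addr.
by exists w; rewrite ?mem_cat ?wq // inE vw orbT.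
Qed.

(** Averaging: if every point of [T] had too many partners, [E] would exceed its linear bound. *)
Lemma hitting_vertex D N T : sparse D N G -> T != set0 ->
  exists2 v, v \in T & exists2 W : {set G}, #|W| <= hitting_bound D N N
    & hits N T v W.
Proof.
move=> GD T0; have [E [Ec EP]] := hitting_relation T GD (leqnn N).
pose W v := [set w | (v, w) \in E].
have [/exists_inP[v vT vW]|] :=
    boolP [exists v in T, #|W v| <= hitting_bound D N N].
  exists v => //; exists (W v) => // p vp sz lT lv.
  by have [w wp vw] := EP v p vT vp sz lT lv; exists w; rewrite ?inE.
rewrite negb_exists_in => /forall_inP WT.
suff : #|T| * (hitting_bound D N N).+1 <= #|E|.
  move=> /leq_trans/(_ Ec); rewrite mulnC leq_mul2r ltnn orbF cards_eq0.
  by rewrite (negbTE T0).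
rewrite -sum_nat_const.
rewrite (@leq_trans (\sum_(v in T) #|W v|)) //.
  by apply: leq_sum => v /WT; rewrite -ltnNge.
rewrite -sum1_card (partition_big fst predT) //=.
rewrite big_mkcond; apply: leq_sum => v _; case: ifP => // _.
rewrite sum1_card.
have vinj : injective (pair v : G -> G * G) by move=> ? ? [].
rewrite -(card_imset _ vinj) subset_leq_card //.
apply/subsetP => _ /imsetP[w /[!inE] vw ->].
by rewrite unfold_in /= eqxx andbT.
Qed.

End Balls.

(** * Ordering the vertices *)

Section Ordering.
Variables (G : sgraph) (K N : nat).

(** The vertex found for [T] receives the largest rank within [T], and the recursion continues with
    [T :\ v]; thus the points ranked no higher than [v] are those of the set from which [v] was
    chosen. *)
Lemma hitting_order :
  (forall T : {set G}, T != set0 ->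
     exists2 v, v \in T & exists2 W : {set G}, #|W| <= K & hits N T v W) ->
  exists rk : G -> nat, injective rk /\ forall v, exists2 W : {set G},
    #|W| <= K & hits N [set u | rk u <= rk v] v W.
Proof.
move=> hT.
suff H m (T : {set G}) : #|T| = m -> exists rk : G -> nat,
    [/\ {in T &, injective rk}, forall u, u \in T -> rk u < m
      & forall v, v \in T -> exists2 W : {set G},
          #|W| <= K & hits N [set u in T | rk u <= rk v] v W].
  have [rk [inj _ rkP]] := H _ [set: G] (erefl _); exists rk; split.
    by move=> u v; apply: inj; rewrite inE.
  move=> v; have [|W WK WP] := rkP v; first by rewrite inE.
  exists W => // p vp sz; rewrite inE => lp lv.
  by apply: WP; rewrite ?inE.
elim: m T => [|m IHm] T Tm.
  move/eqP: Tm; rewrite cards_eq0 => /eqP->.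
  by exists (fun=> 0); split=> [u v|u|u]; rewrite inE.
have [|v vT [W WK WP]] := hT T; first by rewrite -cards_eq0 Tm.
have [|rk [inj lt rkP]] := IHm (T :\ v).
  by move: Tm; rewrite (cardsD1 v) vT => -[].
pose rk' u := if u == v then m else rk u.
have ltv u : u \in T -> u != v -> rk' u < m.
  by move=> uT uv; rewrite /rk' (negbTE uv) lt // !inE uv.
have rk'v : rk' v = m by rewrite /rk' eqxx.
exists rk'; split.
- move=> u w uT wT; have [->|uv] := eqVneq u v; have [->|wv] := eqVneq w v => //.
  + by rewrite rk'v => e; have := ltv _ wT wv; rewrite -e ltnn.
  + by rewrite rk'v => e; have := ltv _ uT uv; rewrite e ltnn.
  + by rewrite /rk' (negbTE uv) (negbTE wv) => /inj; apply; rewrite !inE ?uv ?wv.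
- move=> u uT; have [->|uv] := eqVneq u v; first by rewrite rk'v.
  by rewrite ltnS ltnW // ltv.
- move=> u uT; have [->|uv] := eqVneq u v.
    exists W => // p vp sz; rewrite inE => /andP[lT _].
    exact: WP.
  have [|U UK UP] := rkP u; first by rewrite !inE uv.
  exists U => // p vp sz; rewrite inE => /andP[lT lr] lu.
  apply: UP => //; have lv : last u p != v.
    by apply: contraTneq lr => ->; rewrite rk'v -ltnNge ltv.
  by rewrite !inE lv lT; move: lr; rewrite /rk' (negbTE lv) (negbTE uv).
Qed.

End Ordering.

(** * Weak reachability and greedy colouring *)

Section Linked.
Variable G : sgraph.
Implicit Types (A : pred G) (x y z : G).

Definition linked A n x y : Prop :=
  exists p, [/\ path adj x p, last x p = y, size p <= n & all A (x :: p)].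

Lemma linked0 A n x : A x -> linked A n x x.
Proof. by exists [::]; rewrite /= H. Qed.

Lemma linked_trans A m n y x z :
  linked A m x y -> linked A n y z -> linked A (m + n) x z.
Proof.
move=> [p [xp lp sp pA]] [q [yq lq sq qA]]; exists (p ++ q); split.
- by rewrite cat_path xp lp.
- by rewrite last_cat lp.
- by rewrite size_cat leq_add.
- by rewrite -cat_cons all_cat pA; case/andP: qA.
Qed.

Lemma linked_sym A n x y : linked A n x y -> linked A n y x.
Proof.
move=> [p []]; elim: p n x => [|z p IHp] n x /=.
  by move=> _ <- _ /andP[Ax _]; apply: linked0.
move=> /andP[xz zp] lp; case: n => // n sz /and3P[Ax Az Ap].
rewrite -addn1; apply: (@linked_trans _ _ _ z); first by apply: IHp; rewrite //= Az.
by exists [:: x]; rewrite /= adj_sym xz Az Ax.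
Qed.

Lemma linked_weak A B m n x y :
  subpred A B -> m <= n -> linked A m x y -> linked B n x y.
Proof.
move=> AB mn [p [xp lp sp pA]]; exists p; split=> //; first exact: leq_trans mn.
exact: sub_all pA.
Qed.

Variable rk : G -> nat.

Definition wreach n v : {set G} :=
  [set u | `[< linked [pred w | rk u <= rk w] n v u >]].

(** A walk from [v] to another weakly reachable point meets [W] after at least one step, as [p] does
    not list its start; the rest is shorter and has the same minimum. The count follows from
    [1 + K * K.+1 ^ n <= K.+1 ^ n.+1]. *)
Lemma card_wreach K N n v :
  (forall v, exists2 W : {set G}, #|W| <= K &
     hits N [set u | rk u <= rk v] v W) ->
  n <= N -> #|wreach n v| <= K.+1 ^ n.
Proof.
move=> hW; elim: n v => [|n IHn] v nN.
  rewrite expn0 -(cards1 v) subset_leq_card //; apply/subsetP => u.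
  by rewrite !inE => /asboolP[[|w q] [_ /= <- // _ _]].
have [W WK WP] := hW v.
have sub : wreach n.+1 v \subset v |: \bigcup_(w in W) wreach n w.
  apply/subsetP => u; rewrite !inE => /asboolP[p [vp lp sp pA]].
  have [//|uv] := eqVneq u v; move: pA; rewrite [all _ _]/= => /andP[uv' pA]; subst u.
  have [||w wp wW] := WP p vp (leq_trans sp nN); rewrite ?inE //.
  case/splitPr: wp vp sp pA uv => q1 q2; rewrite -cat_rcons.
  rewrite cat_path last_cat last_rcons size_cat size_rcons all_cat all_rcons.
  move=> /andP[_ wq] sz /andP[/andP[Aw _] Aq] uv.
  apply/bigcupP; exists w => //; rewrite inE; apply/asboolP.
  exists q2; split=> //; last exact/andP.
  by rewrite -ltnS (leq_trans _ sz) // ltnS leq_addl.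
rewrite (leq_trans (subset_leq_card sub)) // cardsU1 expnS mulSn leq_add //.
  by rewrite (leq_trans (leq_b1 _)) // expn_gt0.
have [le_cup] : #|\bigcup_(w in W) wreach n w| <= \sum_(w in W) #|wreach n w|.
  elim/big_rec2: _ => [|w A B _ le]; first by rewrite cards0.
  by rewrite (leq_trans (leq_card_setU _ _)) // leq_add2l.
apply: leq_trans le_cup _.
rewrite (@leq_trans (\sum_(w in W) K.+1 ^ n)) //.
  by apply: leq_sum => w _; apply/IHn/ltnW.
by rewrite sum_nat_const leq_mul2r WK orbT.
Qed.

End Linked.

(** Colours are given in increasing rank: [A v] blocks at most [c] of the [c.+1] colours, and by
    injectivity each rank has at most one vertex. *)
Lemma greedy_colouring (T : finType) (rk : T -> nat) (A : T -> {set T}) c :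
  injective rk -> (forall v, #|A v| <= c) ->
  exists phi : T -> 'I_c.+1, forall u v, u \in A v -> rk u < rk v ->
    phi u != phi v.
Proof.
move=> inj Ac.
suff H m : exists phi : T -> 'I_c.+1, forall u v, u \in A v -> rk u < rk v ->
    rk v < m -> phi u != phi v.
  have [phi phiP] := H (\max_v rk v).+1; exists phi => u v uv lt.
  by apply: phiP => //; rewrite ltnS (leq_bigmax v).
elim: m => [|m [phi phiP]]; first by exists (fun=> ord0).
have [/existsP[v /eqP vm]|nv] := boolP [exists v, rk v == m]; last first.
  exists phi => u v uv lt; rewrite ltnS leq_eqVlt => /predU1P[vm|]; last exact: phiP.
  by case/existsP: nv; exists v; apply/eqP.
have /subsetPn[i _ iA] : ~~ ([set: 'I_c.+1] \subset phi @: A v).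
  apply: contraTN (leq_trans (leq_imset_card phi _) (Ac v)) => /subset_leq_card.
  by rewrite cardsT card_ord -ltnNge.
exists (fun u => if u == v then i else phi u) => u w uw lt.
have uw' : u != w by apply: contraTneq lt => ->; rewrite ltnn.
have [wv|wv] := eqVneq w v; rewrite ltnS leq_eqVlt.
  move=> _; rewrite -wv (negbTE uw').
  by apply: contraNneq iA => <-; apply: imset_f; rewrite -wv.
case/predU1P=> [wm|wm]; first by case/eqP: wv; apply: inj; rewrite wm.
have -> : (u == v) = false.
  by apply: contraTF (ltn_trans lt wm) => /eqP->; rewrite vm ltnn.
exact: phiP.
Qed.

(** * Covering chains, reversible sets of pairs and dimension *)

Section Posets.
Variables (disp : Order.disp_t) (P : finPOrderType disp).
Local Open Scope order_scope.

Lemma covering_path (x y : P) : x <= y ->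
  exists2 p, path (@covered_by _ P) x p & last x p = y.
Proof.
have [m] := ubnP #|[set z | x < z <= y]|; elim: m x => // m IHm x lem xy.
have [<-|nxy] := eqVneq x y; first by exists [::].
have y0 : (x < y <= y) by rewrite lexx lt_neqAle nxy xy.
(* A point of the interval with smallest down-set covers [x]. *)
case: (@arg_minnP _ y (fun z => x < z <= y) (fun z => #|[set w | w <= z]|) y0).
move=> z /andP[xz zy] zmin.
have [|p zp lp] := IHm z _ zy.
  rewrite -ltnS; apply: leq_trans lem; rewrite ltnS; apply/proper_card/properP; split.
    by apply/subsetP => w; rewrite !inE => /andP[/(lt_trans xz)->].
  by exists z; rewrite !inE ?xz ?zy // ltxx.
exists (z :: p) => //=; rewrite zp andbT /covered_by xz /=.
apply/existsP => -[w /andP[xw wz]].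
have := zmin w; rewrite xw (ltW (lt_le_trans wz zy)) => /(_ isT).
rewrite leqNgt => /negP; apply; apply/proper_card/properP; split.
  by apply/subsetP => v; rewrite !inE => /le_trans; apply; apply: ltW.
by exists z; rewrite !inE ?lexx ?(lt_geF wz).
Qed.

Lemma cover_path_height (x : P) p : path (@covered_by _ P) x p ->
  (size p < poset_height P)%N.
Proof.
move=> xp; have sp : sorted <%O (x :: p).
  by apply: sub_path xp => u v /andP[].
rewrite -[(size p).+1]/(size (x :: p)).
rewrite -(card_uniqP (sorted_uniq lt_trans (@ltxx _ P) sp)).
rewrite -[X in (X <= _)%N]cardsE /poset_height.
apply: (@leq_bigmax_cond _ (fun A : {set P} => chain A)).
apply/forall_inP => u; rewrite in_set => up.
apply/forall_inP => v; rewrite in_set => vp.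
elim: (x :: p) sp u v up vp => [_ u v|a s IHs as_ u v] /=; first by [].
have aP w : w \in s -> a < w.
  by apply/allP: w; apply: (order_path_min lt_trans as_).
rewrite !inE => /predU1P[->|us] /predU1P[->|vs].
- exact: comparablexx.
- exact/lt_comparable/aP.
- by rewrite comparable_sym; apply/lt_comparable/aP.
- by apply: IHs => //; apply: path_sorted as_.
Qed.

(** [z] is the point of least rank on a covering chain, which has at most [h.+1] points and so at
    most [h] edges. *)
Lemma linked_le h (rk : P -> nat) (x y : P) :
  (poset_height P <= h.+1)%N -> x <= y ->
  exists z, let A : pred (cover_graph P) := [pred w | rk z <= rk w]%N in
    [/\ x <= z <= y, linked A h x y, linked A h x z & linked A h z y].
Proof.
move=> hP xy; have [p xp lp] := covering_path xy.
have sp : (size p <= h)%N by rewrite -ltnS (leq_trans (cover_path_height xp)).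
have xp' : path (@adj (cover_graph P)) x p.
  by apply: sub_path xp => u v uv; rewrite /adj /= /cover_adj uv.
have lep : path <=%O x p by apply: sub_path xp => u v /andP[/ltW].
have x0 : x \in x :: p by rewrite mem_head.
case: (@arg_minnP _ x (mem (x :: p)) rk x0) => z zp zmin.
have pA : all [pred w | rk z <= rk w]%N (x :: p) by apply/allP => w /zmin.
pose A : pred (cover_graph P) := [pred w | rk z <= rk w]%N.
exists z; case/splitPl: zp lp sp xp' lep pA => p1 p2 lz.
rewrite last_cat lz !cat_path lz size_cat -cat_cons all_cat.
move=> lp sp /andP[xp1 zp2] /andP[lp1 lp2] /andP[A1 A2] /=.
have L1 : linked A h x z.
  by exists p1; split=> //; rewrite (leq_trans _ sp) ?leq_addr.
have L2 : linked A h z y.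
  exists p2; split=> //=; first by rewrite (leq_trans _ sp) ?leq_addl.
  by apply/andP; split; rewrite // /A /= leqnn.
split=> //; last first.
  exists (p1 ++ p2); rewrite cat_path lz xp1 zp2 last_cat lz size_cat.
  by rewrite -cat_cons all_cat A1.
have le_last a s : path <=%O a s -> a <= last a s.
  by elim: s a => //= b s IHs a /andP[ab /IHs]; apply: le_trans.
by rewrite -{1}lz -lp !le_last.
Qed.

(** The criterion by alternating cycles, whose steps are [e]: without them, putting [y] below [x]
    for each [I x y] still generates an order, and this order is extended linearly. *)
Lemma reversing_extension (I : rel P) :
  (forall x y, I x y -> ~~ (x <= y)) ->
  let e (p q : P * P) := [&& I p.1 p.2, I q.1 q.2 & p.1 <= q.2] in
  (forall p q, connect e p q -> ~~ e q p) ->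
  exists2 L : rel P, linear_extension L & forall x y, I x y -> ~~ L x y.
Proof.
move=> Ile e acyc.
(* The closure of [<=] and the reversed pairs; the pairs used by one comparison form an [e]-path
   from [p] to [q]. *)
pose t (a b : P) := (a <= b) || [exists p : P * P, exists q : P * P,
  [&& I p.1 p.2, a <= p.2, connect e p q, I q.1 q.2 & q.1 <= b]].
have tI x y : I x y -> t y x.
  move=> xy; apply/orP; right; apply/existsP; exists (x, y).
  by apply/existsP; exists (x, y); rewrite /= !lexx xy connect0.
have t_trans : transitive t.
  move=> b a c /orP[ab|/existsP[p /existsP[q /and5P[Ip ap pq Iq qb]]]].
    case/orP=> [/(le_trans ab) ac|]; first by rewrite /t ac.
    case/existsP=> p /existsP[q /and5P[Ip bp pq Iq qc]]; apply/orP; right.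
    by apply/existsP; exists p; apply/existsP; exists q; rewrite Ip (le_trans ab) ?pq ?Iq.
  case/orP=> [bc|/existsP[p' /existsP[q' /and5P[Ip' bp' pq' Iq' qc']]]];
    apply/orP; right; apply/existsP; exists p; apply/existsP.
    by exists q; rewrite Ip ap pq Iq (le_trans qb).
  exists q'; rewrite Ip ap Iq' qc' !andbT /=.
  apply: connect_trans pq (connect_trans (connect1 _) pq').
  by rewrite /e Iq Ip' (le_trans qb).
have t_anti : antisymmetric t.
  (* Any way back from a comparison through pairs closes an [e]-cycle, so opposite comparisons both
     come from [<=]. *)
  have t_asym a b p q : I p.1 p.2 -> a <= p.2 -> connect e p q -> I q.1 q.2 ->
      q.1 <= b -> ~~ t b a.
    move=> Ip ap pq Iq qb; apply/negP => /orP[ba|].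
      by have := acyc p q pq; rewrite /e Ip Iq (le_trans qb) ?(le_trans ba).
    case/existsP=> p' /existsP[q' /and5P[Ip' bp' pq' Iq' qa']].
    have := acyc p q'; rewrite /e Ip Iq' (le_trans qa') //= => /(_ _)/negP; apply=> //.
    apply: connect_trans pq (connect_trans (connect1 _) pq').
    by rewrite /e Iq Ip' (le_trans qb).
  move=> a b /andP[ab ba].
  have nab : a <= b.
    case/orP: ab => // /existsP[p /existsP[q /and5P[Ip ap pq Iq qb]]].
    by have := t_asym a b p q Ip ap pq Iq qb; rewrite ba.
  have nba : b <= a.
    case/orP: ba => // /existsP[p /existsP[q /and5P[Ip ap pq Iq qb]]].
    by have := t_asym b a p q Ip ap pq Iq qb; rewrite ab.
  by apply/le_anti; rewrite nab nba.
have t_refl : reflexive t by move=> a; rewrite /t lexx.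
pose c (z : P) : nat := #|[set w : P | t w z]|.
have cP u v : t u v -> u != v -> (c u < c v)%N.
  move=> uv nuv; apply: proper_card; apply/properP; split.
    by apply/subsetP => w; rewrite !inE => /t_trans; apply.
  exists v; rewrite !inE ?t_refl //; apply: contra nuv => vu.
  by apply/eqP/t_anti; rewrite uv vu.
(* Sizes of down-sets increase along [t]; the enumeration breaks ties. *)
pose key (z : P) : (nat *l nat)%type := (c z, nat_of_ord (enum_rank z)).
have keyt u v : t u v -> key u <= key v.
  move=> uv; have [->//|nuv] := eqVneq u v.
  by rewrite lexi_pair leEnat (ltnW (cP _ _ uv nuv)) leqNgt (cP _ _ uv nuv).
have key_anti : antisymmetric (fun u v => key u <= key v).
  by move=> u v /le_anti[_ e']; apply/enum_rank_inj/ord_inj.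
exists (fun u v => key u <= key v).
  split=> //.
  - by move=> v u w; apply: le_trans.
  - by move=> u v; apply: le_total.
  - by move=> u v uv; apply: keyt; rewrite /t uv.
move=> x y xy; apply: contra (Ile _ _ xy) => le.
by rewrite (key_anti x y) // le keyt ?tI.
Qed.

Lemma poset_dim_le (S : finType) (sg : P * P -> S) :
  (forall s, exists2 L : rel P, linear_extension L &
     forall x y, ~~ (x <= y) -> sg (x, y) = s -> ~~ L x y) ->
  (poset_dim P <= #|S|)%N.
Proof.
move=> hL; have /choice[L LP] : forall s, exists L : rel P, linear_extension L /\
    forall x y, ~~ (x <= y) -> sg (x, y) = s -> ~~ L x y.
  by move=> s; have [L ? ?] := hL s; exists L.
rewrite /poset_dim; case: ex_minnP => d _; apply; apply/asboolP.
exists (fun i => L (enum_val i)); split=> [i|x y]; first exact: (LP _).1.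
apply/idP/forallP => [xy i|Lxy]; first by have [_ _ _ s] := (LP (enum_val i)).1; apply: s.
apply: contraT => xy.
have := (LP _).2 x y xy (erefl _).
by have := Lxy (enum_rank (sg (x, y))); rewrite enum_rankK => ->.
Qed.

End Posets.

(** * Signatures against alternating cycles *)

Lemma cycle_closed (T : finType) (e : rel T) p q : connect e p q -> e q p ->
  exists A : pred T, [/\ A p, forall r, A r -> exists2 r', A r' & e r r'
    & forall r, A r -> exists2 r', A r' & e r' r].
Proof.
move=> pq qp; have cqp := connect1 qp.
(* The strong component of [p] stands in for an explicit cycle. *)
exists (fun r => connect e p r && connect e r p); split=> [|r|r].
- by rewrite connect0.
- case/andP=> pr rp; have /connectP[[|r' s] /= rs qs] := connect_trans rp pq.
    by exists p; rewrite ?connect0 // -qs.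
  case/andP: rs => rr' r's; exists r' => //.
  rewrite (connect_trans pr (connect1 rr')) (connect_trans _ cqp) //.
  by apply/connectP; exists s.
- case/andP=> /connectP[s]; case/lastP: s => [_ -> _|s r']; first by exists q; rewrite ?pq.
  rewrite rcons_path last_rcons => /andP[ps sr] -> rp; exists (last p s) => //.
  rewrite (connect_trans (connect1 sr) rp) andbT.
  by apply/connectP; exists s.
Qed.

Section Signature.
Variables (disp : Order.disp_t) (P : finPOrderType disp) (h : nat).
Variables (K : finType) (rk : P -> nat) (phi : P -> K).
Local Notation above z := ([pred w | rk z <= rk w] : pred (cover_graph P)).
Hypotheses (height_le : poset_height P <= h.+1) (rk_inj : injective rk).
Hypothesis phi_wreach : forall a b,
  linked (above a) (3 * h) b a -> phi a = phi b -> a = b.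

Let U (x : P) : {set P} :=
  [set z | (x <= z)%O && `[< linked (above z) h x z >]].
Let D (y : P) : {set P} :=
  [set z | (z <= y)%O && `[< linked (above z) h z y >]].

(** The walk from [u] through [x] and [y] to [d] has length at most [3 * h]. The lower-ranked of [u]
    and [d] ranks at most [z], hence is minimal on all of it and weakly reachable from the other;
    equal colours then force equality. *)
Lemma bridge x y z u d : u \in U x -> d \in D y -> linked (above z) h x y ->
  phi u = phi d -> (rk u <= rk z) || (rk d <= rk z) -> u = d.
Proof.
rewrite !inE => /andP[_ /asboolP xu] /andP[_ /asboolP dy] xy ud zle.
have weak a b v w : rk b <= rk a -> linked (above a) h v w ->
    linked (above b) h v w.
  by move=> ba; apply: linked_weak => // t; apply: leq_trans ba.
have h3 : 3 * h = h + h + h by rewrite !mulSn addn0 addnA.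
case: (leqP (rk u) (rk d)) => [le|/ltnW le].
  have uz : rk u <= rk z by case/orP: zle => // /(leq_trans le).
  apply: phi_wreach ud; rewrite h3.
  apply: linked_trans xu; apply: linked_trans (weak _ _ _ _ le dy) _.
  exact/linked_sym/weak/xy.
have dz : rk d <= rk z by case/orP: zle => // /(leq_trans le).
apply/esym/phi_wreach => //; rewrite h3.
apply: linked_trans (linked_sym dy).
exact: linked_trans (linked_sym (weak _ _ _ _ le xu)) (weak _ _ _ _ dz xy).
Qed.

(** The lower-ranked point is minimal on the walk through [x] that joins the two. *)
Lemma up_inj x u u' : u \in U x -> u' \in U x -> phi u = phi u' -> u = u'.
Proof.
wlog le : u u' / rk u <= rk u'.
  move=> H ux ux' e; case: (leqP (rk u) (rk u')) => [|/ltnW] le; first exact: H.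
  exact/esym/H.
rewrite !inE => /andP[_ /asboolP xu] /andP[_ /asboolP xu'] e.
apply: phi_wreach e; apply: (@linked_weak _ (above u) _ (h + h)) => //.
  by rewrite !mulSn addn0 addnA leq_addr.
apply: linked_trans xu; apply/linked_sym/linked_weak/xu' => // w.
exact: leq_trans.
Qed.

Lemma down_inj y d d' : d \in D y -> d' \in D y -> phi d = phi d' -> d = d'.
Proof.
wlog le : d d' / rk d <= rk d'.
  move=> H dy dy' e; case: (leqP (rk d) (rk d')) => [|/ltnW] le; first exact: H.
  exact/esym/H.
rewrite !inE => /andP[_ /asboolP dy] /andP[_ /asboolP dy'] e.
apply: phi_wreach e; apply: (@linked_weak _ (above d) _ (h + h)) => //.
  by rewrite !mulSn addn0 addnA leq_addr.
apply: linked_trans (linked_sym dy); apply: linked_weak dy' => // w.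
exact: leq_trans.
Qed.

(** By [up_inj] and [down_inj] a colour has at most one bearer on each side, so the last component
    compares the ranks of determined points. *)
Definition signature (p : P * P) : {set K} * {set K} * {set K} :=
  (phi @: U p.1, phi @: D p.2,
   [set i | [exists u, exists d, [&& u \in U p.1, d \in D p.2,
      phi u == i, phi d == i & rk u < rk d]]]).

Lemma alternating_closed (A : pred (P * P)) s p0 : A p0 ->
  (forall p, A p -> ~~ (p.1 <= p.2)%O /\ signature p = s) ->
  (forall p, A p -> exists2 q, A q & (p.1 <= q.2)%O) ->
  ~ (forall p, A p -> exists2 q, A q & (q.1 <= p.2)%O).
Proof.
move=> A0 As Anext Aprev.
(* The candidates for least point of a walk realising some [p.1 <= q.2] within [A]. *)
pose Z z := [exists p, exists q, [&& A p, A q, z \in U p.1, z \in D q.2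
  & `[< linked (above z) h (p.1 : cover_graph P) q.2 >]]].
have ZP p q : A p -> A q -> (p.1 <= q.2)%O -> exists2 z, Z z
    & linked (above z) h (p.1 : cover_graph P) q.2.
  move=> Ap Aq /(linked_le rk height_le)[z [/andP[pz zq] pq Lpz Lzq]].
  exists z => //; apply/existsP; exists p; apply/existsP; exists q.
  by rewrite Ap Aq !inE pz zq /=; apply/and3P; split; apply/asboolP.
have [q0 Aq0 /(ZP _ _ A0 Aq0)[z1 Zz1 _]] := Anext _ A0.
case: (@arg_minnP _ z1 Z rk Zz1) => z Zz zmin {z1 Zz1}.
(* As [z] has least rank in [Z], all comparabilities within [A] are realised by walks above [z], as
   [bridge] requires. *)
have {ZP} link p q : A p -> A q -> (p.1 <= q.2)%O ->
    linked (above z) h (p.1 : cover_graph P) q.2.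
  move=> Ap Aq /(ZP _ _ Ap Aq)[z' /zmin zz'].
  by apply: linked_weak => // w; apply: leq_trans.
case/existsP: Zz => p /existsP[q /and5P[Ap Aq zp zq _]].
have inU r : A r -> exists2 u, u \in U r.1 & phi u = phi z.
  move=> Ar; have /imsetP[u ur ->] : phi z \in phi @: U r.1.
    have -> : phi @: U r.1 = phi @: U p.1.
      by have [_] := As r Ar; have [_ <-] := As p Ap; case.
    exact: imset_f.
  by exists u.
have inD r : A r -> exists2 d, d \in D r.2 & phi d = phi z.
  move=> Ar; have /imsetP[d dr ->] : phi z \in phi @: D r.2.
    have -> : phi @: D r.2 = phi @: D q.2.
      by have [_] := As r Ar; have [_ <-] := As q Aq; case.
    exact: imset_f.
  by exists d.
(* Here [u] ranks below [d] in every pair, and [bridge] identifies [u] with the point of its colour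
   below the next pair: the ranks descend along successors. *)
have [sz|sz] := boolP (phi z \in s.2).
  suff desc n r d : A r -> d \in D r.2 -> phi d = phi z -> rk d <= rk z ->
      rk d < n -> False by exact: (desc (rk z).+1 q z).
  elim: n r d => // n IHn r d Ar dr dz le; rewrite ltnS => lt.
  have := sz; have [_ <-] := As r Ar; rewrite inE.
  move=> /existsP[u /existsP[d' /and5P[ur dr' /eqP uz /eqP d'z ud]]].
  have {d' d'z dr'} ud : rk u < rk d by rewrite (down_inj dr dr') // dz.
  have [r' Ar' rr'] := Anext _ Ar; have [d' dr' d'z] := inD _ Ar'.
  have uz' : rk u <= rk z by apply: ltnW (leq_trans ud le).
  have e : u = d' by apply: (bridge ur dr' (link _ _ Ar Ar' rr')); rewrite ?uz' ?uz.
  by apply: (IHn r' d') => //; rewrite -e // (leq_trans ud).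
(* In the other case the descent runs along predecessors, from [u] to [d]. *)
suff desc n r u : A r -> u \in U r.1 -> phi u = phi z -> rk u <= rk z ->
    rk u < n -> False by exact: (desc (rk z).+1 p z).
elim: n r u => // n IHn r u Ar ur uz le; rewrite ltnS => lt.
have [d dr dz] := inD _ Ar.
(* A common point would give [r.1 <= u <= r.2]; hence the rank drops strictly. *)
have nud : u != d.
  have [nr _] := As _ Ar; apply: contraNneq nr => e.
  by move: ur dr; rewrite -e !inE => /andP[ru _] /andP[/(le_trans ru)].
have du : rk d < rk u.
  rewrite ltn_neqAle (inj_eq rk_inj) eq_sym nud /= leqNgt.
  apply: contra sz => ud; have [_ <-] := As r Ar; rewrite inE.
  by apply/existsP; exists u; apply/existsP; exists d; rewrite ur dr uz dz !eqxx.
have [r' Ar' rr'] := Aprev _ Ar; have [u' ur' u'z] := inU _ Ar'.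
have dz' : rk d <= rk z by apply: ltnW (leq_trans du le).
have e : u' = d.
  by apply: (bridge ur' dr (link _ _ Ar' Ar rr')); rewrite ?dz' ?orbT ?dz.
by apply: (IHn r' u') => //; rewrite e // (leq_trans du).
Qed.

Lemma poset_dim_signature :
  poset_dim P <= #|{: {set K} * {set K} * {set K}}|.
Proof.
apply: (poset_dim_le (sg := signature)) => s.
pose I x y := ~~ (x <= y)%O && (signature (x, y) == s).
have [||L Lext LI] := @reversing_extension _ P I; first by move=> x y /andP[].
  move=> p q pq; apply/negP => qp.
  have [A [Ap Anext Aprev]] := cycle_closed pq qp.
  apply: (@alternating_closed A s p) => // r Ar.
  - by have [r' _ /and3P[/andP[nr /eqP rs] _ _]] := Anext _ Ar; case: r {Ar} nr rs.
  - by have [r' Ar' /and3P[_ _ rr']] := Anext _ Ar; exists r'.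
  - by have [r' Ar' /and3P[_ _ rr']] := Aprev _ Ar; exists r'.
exists L => // x y nxy xys; apply: LI.
by rewrite /I nxy xys eqxx.
Qed.

End Signature.

Theorem theorem1 (R : realType) (C : sgraph -> Prop) (h : nat) :
  bounded_expansion R C -> 1 <= h ->
  exists d : nat, forall (disp : Order.disp_t) (P : finPOrderType disp),
    poset_height P = h -> C (cover_graph P) -> poset_dim P <= d.
Proof.
(* The height is now [h.+1], so comparable points are joined by walks of length at most [h], and
   [bridge] joins three such walks. *)
move=> Cexp; case: h => // h _; pose N := 3 * h.
have [D CD] := bounded_expansion_sparse N Cexp.
(* The bound on weakly [N]-reachable sets, so that [c.+1] colours suffice. *)
pose c := (hitting_bound D N N).+1 ^ N.
exists #|{: {set 'I_c.+1} * {set 'I_c.+1} * {set 'I_c.+1}}| => disp P hP CP.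
have [rk [inj rkP]] := hitting_order (fun T => @hitting_vertex _ _ _ T (CD _ CP)).
have [phi phiP] := greedy_colouring inj (fun v => card_wreach v rkP (leqnn N)).
apply: (@poset_dim_signature _ P h _ rk phi) => // [|a b ba ab].
  by rewrite hP.
have le : rk a <= rk b by case: ba => p [_ _ _ /andP[]].
apply/eqP; apply: contraT => nab.
have := phiP a b; rewrite ab eqxx ltn_neqAle le (inj_eq inj) nab; apply=> //.
by rewrite inE; apply/asboolP.
Qed.
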